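(* Let $K \subset \mathbb{C}$ be a compact, non-polar and polynomially convex set. Let $(q_k)_{k>0}$ be a sequence of complex polynomials of degrees $n_k > 0$ with $n_k \to \infty$ as $k \to \infty$. If $(q_k)_k$ is $K$-regular, then the sequence of derivatives $(q_k')_k$ is also $K$-regular.
   Context: A compact set $K\subset\mathbb{C}$ is polynomially convex if and only if $\Omega := \mathbb{C}\setminus K$ is connected; non-polar means of positive logarithmic capacity. Let $\omega$ be the equilibrium measure of $K$, with energy $I(\omega)=\iint \log|z-w|\,d\omega(z)\,d\omega(w) > -\infty$ (sign convention without a minus sign). The Green's function of $\Omega$ with pole at $\infty$ is $g_\Omega(z) = \int \log|z-w|\,d\omega(w) - I(\omega)$. $K$-regularity: a sequence of polynomials $(p_k)_{k>0}$ of degrees $d_k$ with $d_k\to\infty$ is $K$-regular if for some $R>0$ (which may be enlarged so that $K\subset \mathbb{D}(0,R)$), $$\lim_{k\to\infty} \frac{1}{d_k}\log|p_k(z)| = g_\Omega(z)$$ uniformly on $\mathbb{C}\setminus\mathbb{D}(0,R)$, where $\mathbb{D}(0,R)=\{z:|z|<R\}$. For the sequence $(q_k')_k$ the degrees are $d_k=n_k-1$; the finitely many indices $k$ with $n_k-1=0$ are disregarded, since the condition is asymptotic in $k$. *)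

(* Defs.v *)
From HB Require Import structures.
From mathcomp Require Import all_boot all_order all_algebra.
From mathcomp Require Import complex.
From mathcomp Require Import all_classical all_reals all_analysis.

Set Implicit Arguments.
Unset Strict Implicit.
Unset Printing Implicit Defensive.

Import Order.TTheory GRing.Theory Num.Theory.
Import numFieldNormedType.Exports.

Local Open Scope classical_set_scope.
Local Open Scope ring_scope.

(* R[i] receives the metric topology only through its numFieldType structure,
   which this name makes available to inference. *)
Definition Cplx (R : realType) : numFieldType := R[i]%C.

(* The norm `|z| of z : Cplx R is itself a (real) element of Cplx R;
   Cabs is the modulus with values in R. *)
Definition Cabs (R : realType) (z : Cplx R) : R := ComplexField.Normc.normc z.

(* The plane with its Borel sigma-algebra; a type convertible to Cplx R. *)
Definition borelC (R : realType) := g_sigma_algebraType (@open (Cplx R)).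

Section PotentialTheory.
Variable R : realType.
Implicit Types (K : set (Cplx R)) (mu : probability (borelC R) R).

Local Open Scope ereal_scope.

(* log |z|, with log 0 = -oo *)
Definition logabs (z : Cplx R) : \bar R := lne (Cabs z)%:E.

Definition potential mu (z : Cplx R) : \bar R :=
  \int[mu]_w logabs (z - w)%R.

Definition energy mu : \bar R := \int[mu]_w \int[mu]_z logabs (z - w)%R.

Definition prob_on K : set (probability (borelC R) R) :=
  [set mu | mu K = 1].

(* For K empty the supremum is -oo and the capacity is 0. *)
Definition log_capacity K : \bar R :=
  expeR (ereal_sup [set energy mu | mu in prob_on K]).

Definition nonpolar K : Prop := 0 < log_capacity K.

(* Meant for compact K, for which this is equivalent to K being equal to its
   polynomial hull. *)
Definition polynomially_convex K : Prop := connected (~` K).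

(* Energies carry no minus sign, so equilibrium means maximal energy.  If K is
   compact and non-polar, such an omega exists and is unique. *)
Definition equilibrium_measure K (omega : probability (borelC R) R) : Prop :=
  prob_on K omega /\ forall mu, prob_on K mu -> energy mu <= energy omega.

(* The Green's function of ~` K with pole at infinity, when omega is the
   equilibrium measure of a compact non-polar K. *)
Definition green (omega : probability (borelC R) R) (z : Cplx R) : \bar R :=
  potential omega z - energy omega.

Definition degree (p : {poly Cplx R}) : nat := (size p).-1.

(* The uniform structure of \bar R comes from a bounded metric, which would
   weaken uniform convergence near z = infinity, where green is unbounded;
   hence the explicit epsilon.  At a zero of p k
   (of positive degree) the left-hand side of the inequality is +oo, so the
   condition forbids zeros of p k with r <= |z| for large k. *)
Definition K_regular K (p : nat -> {poly Cplx R}) : Prop :=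
  degree (p k) @[k --> \oo] --> \oo /\
  exists omega, equilibrium_measure K omega /\
  exists2 r : R, (0 < r)%R &
    forall eps : R, (0 < eps)%R ->
      \forall k \near \oo, forall z : Cplx R, (r <= Cabs z)%R ->
        `| ((degree (p k))%:R^-1)%:E * logabs (p k).[z] - green omega z |
          < eps%:E.

End PotentialTheory.

(* Main.v *)
(* Once the roots of q, of degree n, lie in the disc of radius r, the logarithmic
   derivative satisfies z q'(z) / q(z) = sum_a z / (z - a), and each summand is
   within 1/2 of 1 as soon as |z| >= 3 r.  Hence
   log |q'(z)| = log |q(z)| + log n - log |z| + O(1) uniformly on |z| >= 3 r.
   Regularity keeps the roots of q_k in a fixed disc, because log |q_k| = -oo at
   a root; it also bounds green - log |z| there, by comparison with a single
   q_k, so no integral has to be estimated. *)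
Require Import Defs.
From mathcomp Require Import all_boot all_order all_algebra.
From mathcomp Require Import complex.
From mathcomp Require Import all_classical all_reals all_analysis.
From mathcomp Require Import ring lra.
Import Order.TTheory GRing.Theory Num.Theory.
Import numFieldNormedType.Exports.
Local Open Scope classical_set_scope.
Local Open Scope ring_scope.

(** In characteristic zero the top coefficient of the derivative, the degree times [lead_coef p],
    does not vanish. *)
Lemma size_deriv_pchar0 (F : numDomainType) (p : {poly F}) :
  size p^`() = (size p).-1.
Proof.
have [szp|szp] := leqP (size p) 1.
  by rewrite [p](size1_polyC szp) derivC size_poly0 size_polyC; case: eqP.
apply/eqP; rewrite eqn_leq; apply/andP; split.
  by rewrite -ltnS prednK ?lt_size_deriv -?size_poly_gt0 // ltnW.
case n_def: (size p) szp => [|[|n]] //= _.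
rewrite ltnNge; apply: contra_eqN (coef_deriv p n) => /leq_sizeP ->//.
rewrite eq_sym mulrn_eq0 /= -[n.+1]/(n.+2.-1) -n_def -lead_coefE.
by rewrite lead_coef_eq0 -size_poly_gt0 n_def.
Qed.

Section LogarithmicDerivative.
Variable R : realType.
Implicit Types (z a : Cplx R) (p q : {poly Cplx R}) (s : seq (Cplx R)).

Lemma CabsM z a : Cabs (z * a) = Cabs z * Cabs a.
Proof. exact: ComplexField.Normc.normcM. Qed.

Lemma CabsN z : Cabs (- z) = Cabs z.
Proof. exact: normcN. Qed.

Lemma CabsD z a : Cabs (z + a) <= Cabs z + Cabs a.
Proof. exact: le_normcD. Qed.

Lemma CabsBC z a : Cabs (z - a) = Cabs (a - z).
Proof. by rewrite -CabsN opprB. Qed.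

Lemma Cabs_nat n : Cabs (n%:R : Cplx R) = n%:R.
Proof.
apply: etrans (@normcMn R 1 n) _.
by rewrite ComplexField.Normc.normc1.
Qed.

Lemma Cabs_gt0 z : (0 < Cabs z) = (z != 0).
Proof.
apply/idP/idP => [|z0].
  by apply: contraTneq => ->; rewrite [Cabs _]ComplexField.Normc.normc0 ltxx.
rewrite lt_neqAle; apply/andP; split; last by case: (z) => x y; exact: sqrtr_ge0.
by apply: contraNneq z0 => /esym /ComplexField.Normc.eq0_normc ->.
Qed.

Lemma Cabs_sub_le z a : Cabs z <= Cabs (z - a) + Cabs a.
Proof. by rewrite -{1}(subrK a z) CabsD. Qed.

(** Turns comparability up to a factor 2 into an additive error; used for [|z - a|] against [|z|]
    and for [|S|] against the degree. *)
Lemma ln_close (x y : R) : 0 < x -> 0 < y -> x <= 2 * y -> y <= 2 * x ->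
  `|ln x - ln y| <= ln 2.
Proof.
move=> x0 y0 xy yx.
have lxy : ln x <= ln 2 + ln y.
  by rewrite -lnM ?posrE // ler_ln ?posrE // mulr_gt0.
have lyx : ln y <= ln 2 + ln x.
  by rewrite -lnM ?posrE // ler_ln ?posrE // mulr_gt0.
by rewrite ler_norml; apply/andP; split; lra.
Qed.

Definition prod_roots s : {poly Cplx R} := \prod_(a <- s) ('X - a%:P).

Lemma horner_prod_roots_cons a s z :
  (prod_roots (a :: s)).[z] = (z - a) * (prod_roots s).[z].
Proof. by rewrite /prod_roots big_cons hornerM hornerXsubC. Qed.

Lemma Cabs_far z a : z != 0 -> 3 * Cabs a <= Cabs z ->
  [/\ z - a != 0, Cabs (z - a) <= 2 * Cabs z & 2 * Cabs z <= 3 * Cabs (z - a)].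
Proof.
rewrite -!Cabs_gt0 => z0 az.
have := Cabs_sub_le z a; have := CabsD z (- a); rewrite CabsN => h1 h2.
by split; lra.
Qed.

(** Each factor satisfies 2/3 |z| <= |z - a| <= 4/3 |z|, so it costs at most [ln 2]. *)
Lemma ln_prod_roots s z : z != 0 ->
  {in s, forall a, 3 * Cabs a <= Cabs z} ->
  (prod_roots s).[z] != 0 /\
  `|ln (Cabs (prod_roots s).[z]) - (size s)%:R * ln (Cabs z)|
    <= (size s)%:R * ln 2.
Proof.
move=> z0; elim: s => [|a s IH] sz.
  rewrite /prod_roots big_nil hornerC oner_eq0 [Cabs 1]ComplexField.Normc.normc1.
  by rewrite ln1 !mul0r subrr normr0.
have [|P0 IHs] := IH; first by move=> b bs; apply: sz; rewrite inE bs orbT.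
have [za zaL zaU] := Cabs_far z a z0 (sz a (mem_head _ _)).
rewrite horner_prod_roots_cons mulf_neq0 //; split=> //.
have lna : `|ln (Cabs (z - a)) - ln (Cabs z)| <= ln 2.
  by apply: ln_close; rewrite ?Cabs_gt0 //; lra.
rewrite CabsM lnM ?posrE ?Cabs_gt0 //= -natr1.
move: IHs lna; rewrite !ler_norml => /andP[? ?] /andP[? ?].
by apply/andP; split; lra.
Qed.

(** [S] is the sum of z / (z - a) over the roots; multiplying out the logarithmic derivative lets
    the product rule drive the induction. *)
Lemma deriv_prod_roots s z : z != 0 ->
  {in s, forall a, 3 * Cabs a <= Cabs z} ->
  exists2 S, (prod_roots s)^`().[z] * z = (prod_roots s).[z] * S &
    2 * Cabs (S - (size s)%:R) <= (size s)%:R.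
Proof.
move=> z0; elim: s => [|a s IH] sz.
  exists 0; last by rewrite subrr [Cabs 0]ComplexField.Normc.normc0 mulr0.
  by rewrite /prod_roots big_nil derivC horner0 mul0r mulr0.
have [|S PS Sn] := IH; first by move=> b bs; apply: sz; rewrite inE bs orbT.
have az := sz a (mem_head _ _).
have [za zaL zaU] := Cabs_far z a z0 az.
exists (z / (z - a) + S).
  rewrite horner_prod_roots_cons {1}/prod_roots big_cons derivM derivXsubC mul1r.
  rewrite hornerD hornerM hornerXsubC mulrDl -/(prod_roots s).
  by rewrite -[_ * _ * z]mulrA PS; field.
(* The new summand differs from 1 by a / (z - a), of modulus at most 1/2 because 3 |a| <= |z|. *)
have -> : z / (z - a) + S - (size (a :: s))%:R =
    a / (z - a) + (S - (size s)%:R) by rewrite /= -natr1; field.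
have : 2 * Cabs (a / (z - a)) <= 1.
  rewrite CabsM [Cabs _^-1]ComplexField.Normc.normcV -/(Cabs (z - a)).
  by rewrite mulrA ler_pdivrMr ?Cabs_gt0 // mul1r; lra.
by have := CabsD (a / (z - a)) (S - (size s)%:R); rewrite /= -natr1; lra.
Qed.

Lemma roots_factorization p : p != 0 ->
  {s | p = lead_coef p *: prod_roots s & size s = degree p}.
Proof.
move=> p0; have [s ps] := closed_field_poly_normal (p : {poly R[i]%C}).
exists s; first exact: ps.
rewrite /degree {1}ps size_scale ?lead_coef_eq0 //.
by rewrite (@size_prod_XsubC R[i]%C _ s id).
Qed.

(** [B] depends on [p] through its leading coefficient and degree; this is harmless since the bound
    is applied to a single polynomial of the sequence. *)
Lemma ln_poly_growth p : p != 0 -> exists B : R, forall z, z != 0 ->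
  (forall a, root p a -> 3 * Cabs a <= Cabs z) ->
  `|ln (Cabs p.[z]) - (degree p)%:R * ln (Cabs z)| <= B.
Proof.
move=> p0; have [s ps szs] := roots_factorization p p0.
have c0 : lead_coef p != 0 by rewrite lead_coef_eq0.
exists (`|ln (Cabs (lead_coef p))| + (degree p)%:R * ln 2) => z z0 pz.
have [|P0] := ln_prod_roots s z z0.
  move=> a sa; apply: pz.
  by rewrite ps rootZ // /prod_roots root_prod_XsubC.
have -> : p.[z] = lead_coef p * (prod_roots s).[z] by rewrite {1}ps hornerZ.
rewrite CabsM lnM ?posrE ?Cabs_gt0 // szs => Ps.
by rewrite -addrA (le_trans (ler_normD _ _)) // lerD2l.
Qed.

(** Here the error is independent of [p]: the leading coefficient cancels in p' / p, and n/2 <= |S|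
    <= 3n/2 for n the degree. *)
Lemma ln_deriv_poly p z : (0 < degree p)%N -> z != 0 ->
  (forall a, root p a -> 3 * Cabs a <= Cabs z) ->
  p^`().[z] != 0 /\
  `|ln (Cabs p^`().[z]) -
     (ln (Cabs p.[z]) + ln (degree p)%:R - ln (Cabs z))| <= ln 2.
Proof.
move=> n0 z0 pz; have p0 : p != 0.
  by apply: contraTneq n0 => ->; rewrite /degree size_poly0.
have [s ps szs] := roots_factorization p p0.
have c0 : lead_coef p != 0 by rewrite lead_coef_eq0.
have sz : {in s, forall a, 3 * Cabs a <= Cabs z}.
  by move=> a sa; apply: pz; rewrite ps rootZ // /prod_roots root_prod_XsubC.
have [P0 _] := ln_prod_roots s z z0 sz.
have [S PS] := deriv_prod_roots s z z0 sz; rewrite szs => Sn.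
have pS : p^`().[z] * z = p.[z] * S.
  by rewrite ps derivZ !hornerZ -!mulrA PS.
have pz0 : p.[z] != 0 by rewrite ps hornerZ mulf_neq0.
have nR : 0 < (degree p)%:R :> R by rewrite ltr0n.
have := Cabs_sub_le (degree p)%:R S; rewrite CabsBC Cabs_nat => Slow.
have := CabsD (S - (degree p)%:R) (degree p)%:R; rewrite subrK Cabs_nat => Sup.
have S0 : S != 0 by rewrite -Cabs_gt0; lra.
have p'z0 : p^`().[z] != 0.
  by apply: contraTneq (mulf_neq0 pz0 S0) => p'0; rewrite -pS p'0 mul0r eqxx.
split=> //.
have : ln (Cabs p^`().[z]) + ln (Cabs z) = ln (Cabs p.[z]) + ln (Cabs S).
  by rewrite -!lnM ?posrE ?Cabs_gt0 // -!CabsM pS.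
have : `|ln (Cabs S) - ln (degree p)%:R| <= ln 2.
  by apply: ln_close; rewrite ?Cabs_gt0 //; lra.
rewrite !ler_norml => /andP[? ?] ?.
by apply/andP; split; lra.
Qed.

End LogarithmicDerivative.

Section Regularity.
Variable R : realType.
Implicit Types (z : Cplx R) (p : {poly Cplx R}).

Lemma logabsE z : z != 0 -> logabs z = (ln (Cabs z))%:E.
Proof. by move=> z0; rewrite /logabs lne_EFin // Cabs_gt0. Qed.

Lemma logabs0 : logabs (0 : Cplx R) = -oo%E.
Proof. by rewrite /logabs [Cabs 0]ComplexField.Normc.normc0 /= lexx. Qed.

(** A distance below [eps] forces both terms to be finite. At a zero of [p] the difference is [-oo]
    whatever the value of [green], since [-oo] absorbs every summand. *)
Lemma log_near_green (omega : probability (borelC R) R) p z (eps : R) :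
  (0 < degree p)%N ->
  (`| ((degree p)%:R^-1)%:E * logabs p.[z] - green omega z | < eps%:E)%E ->
  p.[z] != 0 /\ exists2 g : R, green omega z = g%:E &
    `|(degree p)%:R^-1 * ln (Cabs p.[z]) - g| < eps.
Proof.
move=> n0; have [->|pz0] := eqVneq p.[z] 0.
  by rewrite logabs0 gt0_muleNy // lte_fin invr_gt0 ltr0n.
rewrite logabsE //; case: (green omega z) => [g| |] //= h.
by split=> //; exists g.
Qed.

(** The free slope [d] makes this an explicit form of ln n = o(n). *)
Lemma ln_le_affine (x d : R) : 0 < x -> 0 < d -> ln x <= d * x - ln d.
Proof.
move=> x0 d0; have := ltW (ln_sublinear (mulr_gt0 d0 x0)).
by rewrite lnM ?posrE //; lra.
Qed.

End Regularity.

Theorem theorem2 (R : realType) (K : set (Cplx R))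
    (q : nat -> {poly Cplx R}) :
  compact K -> nonpolar K -> polynomially_convex K ->
  (forall k, (0 < k)%N -> (0 < degree (q k))%N) ->
  degree (q k) @[k --> \oo] --> \oo ->
  K_regular K q ->
  K_regular K (fun k => (q k)^`()).
Proof.
move=> _ _ _ _ /cvgnyPgt qdeg [_ [omega [eq_omega [r r0 qreg]]]].
have degq' k : degree (q k)^`() = (degree (q k)).-1.
  by rewrite /degree size_deriv_pchar0.
split.
  apply/cvgnyPgt => A; near=> k; rewrite degq' -ltnS prednK.
    by near: k; exact: qdeg A.+1.
  by near: k; exact: qdeg 0.
(* Roots of [q k] will satisfy |a| < r, so the radius [3 * r] ensures 3 |a| <= |z|. *)
exists omega; split=> //; exists (3 * r); first by rewrite mulr_gt0.
have far k (eps : R) z : (0 < degree (q k))%N ->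
    (forall w : Cplx R, r <= Cabs w ->
       (`| ((degree (q k))%:R^-1)%:E * logabs (q k).[w] - green omega w |
          < eps%:E)%E) ->
    3 * r <= Cabs z ->
    [/\ z != 0, forall a, root (q k) a -> 3 * Cabs a <= Cabs z &
      exists2 g : R, green omega z = g%:E &
        `|(degree (q k))%:R^-1 * ln (Cabs (q k).[z]) - g| < eps].
  move=> n0 H rz; split.
  - by rewrite -Cabs_gt0; lra.
  - move=> a /rootP qa0; have [ra|] := leP r (Cabs a); last by lra.
    by have [] := log_near_green R omega (q k) a eps n0 (H a ra); rewrite qa0 eqxx.
  - have rz' : r <= Cabs z by lra.
    by have [_] := log_near_green R omega (q k) z eps n0 (H z rz').
(* One index [k] that is good for the tolerance 1 suffices, as [green] does not depend on [k]. *)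
have [C green_growth] : exists C : R, forall z, 3 * r <= Cabs z ->
    exists2 g : R, green omega z = g%:E & `|g - ln (Cabs z)| <= C.
  have [k [k1 n0]] := filter_ex (filterI (qreg 1 ltr01) (qdeg 0%N)).
  have qk0 : q k != 0 by apply: contraTneq n0 => ->; rewrite /degree size_poly0.
  have [B qB] := ln_poly_growth R (q k) qk0.
  exists (1 + (degree (q k))%:R^-1 * B) => z rz.
  have [z0 qz [g gE gq]] := far k 1 z n0 k1 rz.
  exists g => //; have nR : 0 < (degree (q k))%:R :> R by rewrite ltr0n.
  have := qB z z0 qz; rewrite -(ler_pM2l (_ : 0 < (degree (q k))%:R^-1)) ?invr_gt0 //.
  rewrite -{1}[_^-1]gtr0_norm ?invr_gt0 // -normrM mulrBr mulKf ?gt_eqF //.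
  move: gq; rewrite ltr_norml !ler_norml => /andP[? ?] /andP[? ?].
  by apply/andP; split; lra.
(* Error budget, n being the degree: regularity and the linear part of the bound on ln n cost eps n
   / 8 each, and [D] collects the constants. The total eps n / 4 + D must stay below eps (n - 1),
   which [nD] guarantees. *)
move=> eps eps0; have d0 : 0 < eps / 8 by rewrite divr_gt0.
pose D := C + ln 2 + `|ln (eps / 8)|.
near=> k => z rz.
have n2 : (2 <= degree (q k))%N by near: k; exact: qdeg 1%N.
have nD : 2 * (D + eps) < eps * (degree (q k))%:R.
  rewrite mulrC -ltr_pdivrMl // mulrC.
  apply: le_lt_trans (ler_norm _) _.
  apply: lt_trans (archi_boundP (normr_ge0 _)) _; rewrite ltr_nat.
  by near: k; exact: qdeg.
have n0 : (0 < degree (q k))%N by exact: ltnW.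
have [|z0 qz [g gE gq]] := far k (eps / 8) z n0 _ rz.
  by near: k; exact: qreg.
have [q'z0 lnq'] := ln_deriv_poly R (q k) z n0 z0 qz.
have [g' ] := green_growth z rz; rewrite gE => -[<-] gC.
have nR : 2 <= (degree (q k))%:R :> R by rewrite ler_nat.
rewrite logabsE // degq' -EFinM -EFinB abse_EFin lte_fin -subn1 natrB //.
move: nD gq lnq' gC (ln_le_affine R (degree (q k))%:R (eps / 8)).
have := ln_ge0 (le_trans (ler1n _ 2) nR : 1 <= (degree (q k))%:R :> R).
move: (degree _)%:R nR => n nR lnn0 nD gq lnq' gC /(_ _ d0) lnn.
have {}lnn : ln n <= eps / 8 * n + `|ln (eps / 8)|.
  have := ler_norm (- ln (eps / 8)); rewrite normrN.
  by have := lnn _; lra.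
have m0 : 0 < n - 1 by lra.
have {}gq : `|ln (Cabs (q k).[z]) - n * g| < eps / 8 * n.
  rewrite -ltr_pdivrMr; last by lra.
  rewrite -{2}[n]gtr0_norm; last by lra.
  by rewrite -normf_div mulrBl mulrAC divff ?mul1r 1?mulrC // gt_eqF //; lra.
(* Up to an error [ln 2], the numerator is (ln |q| - n g) + (g - ln |z|) + ln n: the degree drop
   leaves one extra g, which compensates the - ln |z| coming from the derivative. *)
have -> : (n - 1)^-1 * ln (Cabs (q k)^`().[z]) - g
    = (ln (Cabs (q k)^`().[z]) - (n - 1) * g) / (n - 1).
  by field; rewrite gt_eqF.
rewrite normf_div (gtr0_norm m0) ltr_pdivrMr //.
rewrite /D in nD; move: gq lnq' gC; rewrite !ltr_norml !ler_norml.
move=> /andP[? ?] /andP[? ?] /andP[? ?].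
have := normr_ge0 (ln (eps / 8)) => absln0.
by apply/andP; split; nra.
Unshelve. all: by end_near.
Qed.
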